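(* Let $n\ge 1$, let $S=(s_{ij})\in\mathbb{R}^{n\times n}$ be symmetric with $s_{ii}=0$ for all $i$, let $\mu\in\mathbb{R}^n$ and $\beta>0$ be fixed. For $\alpha\in\mathbb{R}$ let $$U_{\mathrm{aSB}}(\mathbf{x})=\sum_{i=1}^n\tfrac14 x_i^4+\tfrac{\beta-\alpha^2}{2}\mathbf{x}^{\mathsf T}\mathbf{x}-\tfrac12\mathbf{x}^{\mathsf T}S\mathbf{x}-\alpha\,\mu\cdot\mathbf{x},\qquad \mathbf{x}\in\mathbb{R}^n.$$ Let $\alpha_*$ be the explicit threshold, depending only on $S,\mu,\beta$, defined in the context. If $\alpha>\alpha_*$ and $\mathbf{x}_0$ is a global minimizer of $U_{\mathrm{aSB}}$ on $\mathbb{R}^n$, then $\operatorname{sgn}(\mathbf{x}_0)$ is a global minimizer of the Ising energy $E(\mathbf{v})=-\tfrac12\mathbf{v}^{\mathsf T}S\mathbf{v}-\mu\cdot\mathbf{v}$ over $\mathbf{v}\in\{-1,1\}^n$.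
   Context: The sign function is applied coordinatewise. Put $\mathcal{C}=\{-1,1\}^n$, $R_*=\max_i\sum_j|s_{ij}|$, $M_*=\max_i|\mu_i|$. Let $\Delta_*$ be the smallest nonzero value of $|E(\mathbf{v}')-E(\mathbf{v}'')|$ over $\mathbf{v}',\mathbf{v}''\in\mathcal{C}$, with $\Delta_*=1$ if $E$ is constant on $\mathcal{C}$. Let $C_*=n\left(\tfrac54+\tfrac32|\beta|+\tfrac32R_*+M_*\right)$ and $$\alpha_*=\max\left\{1,\;C_*,\;\frac{2C_*}{\Delta_*},\;5(2R_*+2|\beta|+M_*+1),\;\sqrt{R_*+|\beta|+\tfrac{M_*}{2}},\;\sqrt{3+|\beta|+R_*}\right\}.$$ *)

(* Defs.v *)
From mathcomp Require Import all_boot all_order all_algebra.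
From mathcomp Require Import boolp classical_sets functions cardinality reals.

Set Implicit Arguments.
Unset Strict Implicit.
Unset Printing Implicit Defensive.

Import Order.TTheory GRing.Theory Num.Theory.

Local Open Scope classical_set_scope.
Local Open Scope ring_scope.

Definition is_global_min (R : realType) (T : Type) (A : set T) (f : T -> R)
    (x : T) : Prop :=
  A x /\ forall y, A y -> f x <= f y.

Definition cube (R : realType) (n : nat) : set 'cV[R]_n :=
  [set v | forall i, v i 0 = -1 \/ v i 0 = 1].

(* [Num.sg 0 = 0], so [sgn x] lies in the cube only if no coordinate of [x]
   vanishes. *)
Definition sgn (R : realType) (n : nat) (x : 'cV[R]_n) : 'cV[R]_n :=
  map_mx Num.sg x.

Definition dotv (R : realType) (n : nat) (x y : 'cV[R]_n) : R :=
  (x^T *m y) 0 0.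

Definition ising_energy (R : realType) (n : nat) (S : 'M[R]_n)
    (mu v : 'cV[R]_n) : R :=
  - (1 / 2) * dotv v (S *m v) - dotv mu v.

Definition aSB_potential (R : realType) (n : nat) (S : 'M[R]_n)
    (mu : 'cV[R]_n) (beta alpha : R) (x : 'cV[R]_n) : R :=
  (\sum_(i < n) 1 / 4 * x i 0 ^+ 4) + (beta - alpha ^+ 2) / 2 * dotv x x
  - 1 / 2 * dotv x (S *m x) - alpha * dotv mu x.

(* The base value 0 of the two maxima below is harmless: all terms are
   nonnegative. *)
Definition max_row_sum (R : realType) (n : nat) (S : 'M[R]_n) : R :=
  \big[Num.max/0]_(i < n) \sum_(j < n) `|S i j|.

Definition max_entry (R : realType) (n : nat) (mu : 'cV[R]_n) : R :=
  \big[Num.max/0]_(i < n) `|mu i 0|.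

Definition energy_gaps (R : realType) (n : nat) (S : 'M[R]_n)
    (mu : 'cV[R]_n) : set R :=
  [set d | d <> 0 /\ exists v' v'' : 'cV[R]_n, [/\ cube v', cube v'' &
     d = `|ising_energy S mu v' - ising_energy S mu v''|]].

(* [xget 1 P] is an element of [P] if there is one, and 1 otherwise; see
   [min_gapP] and [min_gap_const]. *)
Definition min_gap (R : realType) (n : nat) (S : 'M[R]_n)
    (mu : 'cV[R]_n) : R :=
  xget 1 (is_global_min (energy_gaps S mu) id).

Definition C_star (R : realType) (n : nat) (S : 'M[R]_n) (mu : 'cV[R]_n)
    (beta : R) : R :=
  n%:R * (5 / 4 + 3 / 2 * `|beta| + 3 / 2 * max_row_sum S + max_entry mu).

Definition alpha_star (R : realType) (n : nat) (S : 'M[R]_n) (mu : 'cV[R]_n)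
    (beta : R) : R :=
  let Rs := max_row_sum S in
  let Ms := max_entry mu in
  let C := C_star S mu beta in
  Num.max 1
    (Num.max C
      (Num.max (2 * C / min_gap S mu)
        (Num.max (5 * (2 * Rs + 2 * `|beta| + Ms + 1))
          (Num.max (Num.sqrt (Rs + `|beta| + Ms / 2))
                   (Num.sqrt (3 + `|beta| + Rs)))))).

Lemma cubeP (R : realType) (n : nat) (v : 'cV[R]_n) :
  cube v <-> exists s : {ffun 'I_n -> bool}, v = \col_i (-1) ^+ s i.
Proof.
split=> [cv | [s ->] i]; last first.
  by rewrite mxE; case: (s i); rewrite ?expr1 ?expr0; [left | right].
exists [ffun i => v i 0 == -1]; apply/matrixP => i j.
rewrite !mxE ffunE (ord1 j); case: (cv i) => ->; first by rewrite eqxx expr1.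
by rewrite -addr_eq0 -[1 + 1]/(2%:R) pnatr_eq0 expr0.
Qed.

Lemma min_gapP (R : realType) (n : nat) (S : 'M[R]_n) (mu : 'cV[R]_n) :
  (exists v' v'' : 'cV[R]_n, [/\ cube v', cube v'' &
     ising_energy S mu v' <> ising_energy S mu v'']) ->
  is_global_min (energy_gaps S mu) id (min_gap S mu).
Proof.
pose sp (s : {ffun 'I_n -> bool}) : 'cV[R]_n := \col_i (-1) ^+ s i.
pose gap (p : {ffun 'I_n -> bool} * {ffun 'I_n -> bool}) :=
  `|ising_energy S mu (sp p.1) - ising_energy S mu (sp p.2)|.
have cube_sp s : cube (sp s) by apply/cubeP; exists s.
move=> [v' [v'' [/cubeP[s1 ->] /cubeP[s2 ->] neq]]].
have gap0 : gap (s1, s2) != 0.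
  by rewrite normr_eq0 subr_eq0; apply/eqP.
have [p p0 pmin] := @arg_minP _ _ _ (s1, s2) (fun p => gap p != 0) gap gap0.
apply: (@xgetPex _ 1 (is_global_min (energy_gaps S mu) id)).
exists (gap p); split.
  by split; [exact/eqP | exists (sp p.1), (sp p.2); split].
move=> d [/eqP d0 [w' [w'' [/cubeP[t1 e1] /cubeP[t2 e2] ed]]]].
by rewrite ed e1 e2 in d0 *; exact: (pmin (t1, t2)).
Qed.

Lemma min_gap_const (R : realType) (n : nat) (S : 'M[R]_n) (mu : 'cV[R]_n) :
  (forall v' v'' : 'cV[R]_n, cube v' -> cube v'' ->
     ising_energy S mu v' = ising_energy S mu v'') ->
  min_gap S mu = 1.
Proof.
move=> h; apply: xgetPN => d [[d0 [v' [v'' [c1 c2 e]]]] _].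
by apply: d0; rewrite e (h _ _ c1 c2) subrr normr0.
Qed.

(* Main.v *)
(** Substituting [x = alpha *: y] turns the potential, up to the factor
    [alpha ^+ 2] and an additive constant, into
    [alpha ^+ 2 / 4 * \sum_i (y_i ^+ 2 - 1) ^+ 2 + beta / 2 * |y| ^+ 2 + E y].
    Let [s] be a sign vector of a minimizer [y] and [t_i = |y_i| - 1].  As
    [t_i >= -1], the quartic term is at least [t_i ^+ 2], while replacing [y] by
    [s] in the other terms costs at most [K |t_i| + R_* / 2 * t_i ^+ 2] per
    coordinate, where [K = beta + R_* + M_*].  For large [alpha] each coordinate
    thus contributes at least [- 2 K / (5 alpha)], so that all of them together
    cannot make up for an energy gap of [s] to a better spin configuration.
    A coordinate with [y_i = 0] would contribute a positive amount (more than 1)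
    to the excess over [s], which the others cannot make up for either. *)

Require Import Defs.
From mathcomp Require Import all_boot all_order all_algebra.
From mathcomp Require Import boolp classical_sets reals.
From mathcomp Require Import ring lra.

Set Implicit Arguments.
Unset Strict Implicit.

Import Order.TTheory GRing.Theory Num.Theory.

Local Open Scope classical_set_scope.
Local Open Scope ring_scope.

(** * Expansion and bilinearity of [dotv] *)

Lemma dotvE (R : realType) (n : nat) (x y : 'cV[R]_n) :
  dotv x y = \sum_i x i 0 * y i 0.
Proof. by rewrite /dotv mxE; apply: eq_bigr => i _; rewrite mxE. Qed.

Lemma dotv_mulmxE (R : realType) (n : nat) (S : 'M[R]_n) (x y : 'cV[R]_n) :
  dotv x (S *m y) = \sum_i \sum_j x i 0 * (S i j * y j 0).
Proof. by rewrite dotvE; apply: eq_bigr => i _; rewrite mxE mulr_sumr. Qed.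

Lemma dotv_mulmxC (R : realType) (n : nat) (S : 'M[R]_n) (x y : 'cV[R]_n) :
  S^T = S -> dotv x (S *m y) = dotv y (S *m x).
Proof.
move=> S_sym; rewrite !dotv_mulmxE exchange_big; apply: eq_bigr => i _.
by apply: eq_bigr => j _; rewrite -{1}S_sym mxE; ring.
Qed.

Lemma dotvDl (R : realType) (n : nat) (x y z : 'cV[R]_n) :
  dotv (x + y) z = dotv x z + dotv y z.
Proof. by rewrite /dotv linearD /= mulmxDl mxE. Qed.

Lemma dotvDr (R : realType) (n : nat) (x y z : 'cV[R]_n) :
  dotv x (y + z) = dotv x y + dotv x z.
Proof. by rewrite /dotv mulmxDr mxE. Qed.

Lemma dotvZl (R : realType) (n : nat) (a : R) (x y : 'cV[R]_n) :
  dotv (a *: x) y = a * dotv x y.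
Proof. by rewrite /dotv linearZ /= -scalemxAl mxE. Qed.

Lemma dotvZr (R : realType) (n : nat) (a : R) (x y : 'cV[R]_n) :
  dotv x (a *: y) = a * dotv x y.
Proof. by rewrite /dotv -scalemxAr mxE. Qed.

(** * Bounds on the linear and quadratic parts of the Ising energy *)

Lemma row_sum_le_max (R : realType) (n : nat) (S : 'M[R]_n) (i : 'I_n) :
  \sum_j `|S i j| <= max_row_sum S.
Proof. by apply: (le_bigmax _ (fun i => \sum_j `|S i j|)). Qed.

Lemma max_row_sum_ge0 (R : realType) (n : nat) (S : 'M[R]_n) :
  0 <= max_row_sum S.
Proof. exact: bigmax_ge_id. Qed.

Lemma entry_le_max (R : realType) (n : nat) (mu : 'cV[R]_n) (i : 'I_n) :
  `|mu i 0| <= max_entry mu.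
Proof. by apply: (le_bigmax _ (fun i => `|mu i 0|)). Qed.

Lemma max_entry_ge0 (R : realType) (n : nat) (mu : 'cV[R]_n) :
  0 <= max_entry mu.
Proof. exact: bigmax_ge_id. Qed.

Lemma dotv_le_max_entry (R : realType) (n : nat) (mu d : 'cV[R]_n) :
  dotv mu d <= max_entry mu * \sum_i `|d i 0|.
Proof.
rewrite dotvE mulr_sumr; apply: ler_sum => i _.
apply: le_trans (ler_norm _) _; rewrite normrM.
by apply: ler_wpM2r => //; exact: entry_le_max.
Qed.

Lemma cube_norm (R : realType) (n : nat) (v : 'cV[R]_n) (i : 'I_n) :
  cube v -> `|v i 0| = 1.
Proof. by move=> /(_ i)[] ->; rewrite ?normrN normr1. Qed.

Lemma dotv_mulmx_cube_le (R : realType) (n : nat) (S : 'M[R]_n)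
    (d v : 'cV[R]_n) :
  cube v -> dotv d (S *m v) <= max_row_sum S * \sum_i `|d i 0|.
Proof.
move=> cv; rewrite dotvE mulr_sumr; apply: ler_sum => i _.
apply: le_trans (ler_norm _) _; rewrite normrM mulrC.
apply: ler_wpM2r => //; rewrite mxE; apply: le_trans (row_sum_le_max S i).
apply: le_trans (ler_norm_sum _ _ _) _; apply: ler_sum => j _.
by rewrite normrM cube_norm// mulr1.
Qed.

(** Schur test: [2 * |d_i d_j| <= d_i ^+ 2 + d_j ^+ 2], and by symmetry column sums of [|S i j|]
    equal row sums, so both squares yield the same double sum. *)
Lemma dotv_mulmx_le (R : realType) (n : nat) (S : 'M[R]_n) (d : 'cV[R]_n) :
  S^T = S -> dotv d (S *m d) <= max_row_sum S * \sum_i d i 0 ^+ 2.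
Proof.
move=> S_sym; rewrite dotv_mulmxE.
pose F i j : R := `|S i j| * d i 0 ^+ 2.
have FE : \sum_i \sum_j (F i j + F j i) = 2 * \sum_i \sum_j F i j.
  under eq_bigr => i _ do rewrite big_split.
  rewrite big_split /= [X in _ + X]exchange_big /=; ring.
apply: (@le_trans _ _ (\sum_i \sum_j F i j)); last first.
  rewrite mulr_sumr; apply: ler_sum => i _; rewrite -mulr_suml.
  by apply: ler_wpM2r; [exact: sqr_ge0 | exact: row_sum_le_max].
suff : 2 * \sum_i \sum_j d i 0 * (S i j * d j 0) <= 2 * \sum_i \sum_j F i j.
  by rewrite ler_pM2l.
rewrite -FE mulr_sumr; apply: ler_sum => i _.
rewrite mulr_sumr; apply: ler_sum => j _.
have -> : F j i = `|S i j| * d j 0 ^+ 2 by rewrite /F -{1}S_sym mxE.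
have le_abs : d i 0 * (S i j * d j 0) <= `|d i 0| * (`|S i j| * `|d j 0|).
  by rewrite -!normrM ler_norm.
rewrite /F -(real_normK (num_real (d i 0))) -(real_normK (num_real (d j 0))).
have := mulr_ge0 (normr_ge0 (S i j)) (sqr_ge0 (`|d i 0| - `|d j 0|)); nra.
Qed.

(** Exact second-order expansion at [s]. The linear coefficient [S *m s + mu] is bounded entrywise
    because [s] has entries of modulus 1. *)
Lemma ising_energyD_ge (R : realType) (n : nat) (S : 'M[R]_n)
    (mu s d : 'cV[R]_n) : S^T = S -> cube s ->
  ising_energy S mu s - (max_row_sum S + max_entry mu) * (\sum_i `|d i 0|)
    - max_row_sum S / 2 * (\sum_i d i 0 ^+ 2) <= ising_energy S mu (s + d).
Proof.
move=> S_sym cs; rewrite /ising_energy mulmxDr !dotvDl !dotvDr.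
rewrite (dotv_mulmxC s d)//.
have := dotv_le_max_entry mu d; have := dotv_mulmx_le d S_sym.
have := dotv_mulmx_cube_le S d cs; lra.
Qed.

(** * The rescaled potential and its excess over a sign vector *)

Lemma aSB_potentialZ (R : realType) (n : nat) (S : 'M[R]_n) (mu : 'cV[R]_n)
    (beta a : R) (y : 'cV[R]_n) :
  aSB_potential S mu beta a (a *: y) = a ^+ 2 *
    (\sum_i (a ^+ 2 / 4 * (y i 0 ^+ 2 - 1) ^+ 2 + beta / 2 * (y i 0 ^+ 2 - 1))
     + ising_energy S mu y + n%:R * (beta / 2 - a ^+ 2 / 4)).
Proof.
rewrite /aSB_potential /ising_energy -scalemxAr !dotvZl !dotvZr.
have -> : n%:R * (beta / 2 - a ^+ 2 / 4) =
    \sum_(i < n) (beta / 2 - a ^+ 2 / 4).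
  by rewrite sumr_const card_ord mulr_natl.
have -> : \sum_(i < n) 1 / 4 * (a *: y) i 0 ^+ 4 =
   a ^+ 4 / 4 * \sum_i y i 0 ^+ 4.
  by rewrite mulr_sumr; apply: eq_bigr => i _; rewrite mxE; field.
have -> : \sum_i (a ^+ 2 / 4 * (y i 0 ^+ 2 - 1) ^+ 2
      + beta / 2 * (y i 0 ^+ 2 - 1)) = a ^+ 2 / 4 * (\sum_i y i 0 ^+ 4)
    + (beta / 2 - a ^+ 2 / 2) * dotv y y
    - \sum_(i < n) (beta / 2 - a ^+ 2 / 4).
  rewrite dotvE !mulr_sumr -big_split -sumrB.
  by apply: eq_bigr => i _ /=; field.
by field.
Qed.

Lemma aSB_potentialZ_cube (R : realType) (n : nat) (S : 'M[R]_n)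
    (mu : 'cV[R]_n) (beta a : R) (v : 'cV[R]_n) : cube v ->
  aSB_potential S mu beta a (a *: v) =
    a ^+ 2 * (ising_energy S mu v + n%:R * (beta / 2 - a ^+ 2 / 4)).
Proof.
move=> cv; rewrite aSB_potentialZ big1 ?add0r// => i _.
by case: (cv i) => ->; field.
Qed.

Lemma quartic_ge (R : realType) (b y : R) : 0 <= b ->
  (`|y| - 1) ^+ 2 <= (y ^+ 2 - 1) ^+ 2 /\
  - b * `| `|y| - 1| <= b / 2 * (y ^+ 2 - 1).
Proof.
move=> b0; rewrite -(real_normK (num_real y)).
have := normr_ge0 y; move: (`|y|) => z z0; split.
  have -> : (z ^+ 2 - 1) ^+ 2 = (z - 1) ^+ 2 * (z + 1) ^+ 2 by ring.
  by have := sqr_ge0 (z - 1); nra.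
have -> : b / 2 * (z ^+ 2 - 1) = b * ((z - 1) + (z - 1) ^+ 2 / 2) by field.
rewrite mulNr -mulrN ler_wpM2l//.
have := ler_norm (- (z - 1)); rewrite normrN; have := sqr_ge0 (z - 1); lra.
Qed.

(** Used at [t = |y_i| - 1]: [K * |t|] collects the losses of the [beta] term and of the linear part
    of the energy, [rho / 2 * t ^+ 2] that of its quadratic part. *)
Definition coord_excess (R : realType) (rho K a t : R) : R :=
  a ^+ 2 / 4 * t ^+ 2 - K * `|t| - rho / 2 * t ^+ 2.

(** The competitor [v] is kept apart from [s]: taking [v := s] excludes zero coordinates, taking a
    better configuration gives optimality. Where [y i 0 = 0], the sign [s i 0] is free. *)
Lemma aSB_minimizer_excess (R : realType) (n : nat) (S : 'M[R]_n)
    (mu : 'cV[R]_n) (beta a : R) (s v y : 'cV[R]_n) :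
  S^T = S -> 0 <= beta -> 0 < a -> cube s -> cube v ->
  (forall i, y i 0 = s i 0 * `|y i 0|) ->
  aSB_potential S mu beta a (a *: y) <= aSB_potential S mu beta a (a *: v) ->
  \sum_i coord_excess (max_row_sum S)
           (beta + max_row_sum S + max_entry mu) a (`|y i 0| - 1)
    <= ising_energy S mu v - ising_energy S mu s.
Proof.
move=> S_sym b0 a0 cs cv ys.
rewrite aSB_potentialZ (aSB_potentialZ_cube _ _ _ _ cv) ler_pM2l ?exprn_gt0//.
rewrite lerD2r => le_v.
have := ising_energyD_ge mu (y - s) S_sym cs; rewrite (addrC s) subrK => le_E.
(* Coordinatewise, [y - s] is [s_i * (|y_i| - 1)]. *)
have dE i : `|(y - s) i 0| = `| `|y i 0| - 1|.
  rewrite !mxE {1}ys -{2}(mulr1 (s i 0)) -mulrBr normrM.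
  by rewrite (cube_norm i cs) mul1r.
have le_sum : \sum_i coord_excess (max_row_sum S)
      (beta + max_row_sum S + max_entry mu) a (`|y i 0| - 1)
    <= \sum_i (a ^+ 2 / 4 * (y i 0 ^+ 2 - 1) ^+ 2
               + beta / 2 * (y i 0 ^+ 2 - 1))
     - (max_row_sum S + max_entry mu) * (\sum_i `|(y - s) i 0|)
     - max_row_sum S / 2 * (\sum_i (y - s) i 0 ^+ 2).
  rewrite !mulr_sumr -!sumrB; apply: ler_sum => i _.
  rewrite -(real_normK (num_real ((y - s) i 0))) dE.
  rewrite real_normK ?num_real// /coord_excess.
  have [q1 q2] := quartic_ge (y i 0) b0.
  have := ler_wpM2l (divr_ge0 (sqr_ge0 a) (ler0n R 4)) q1; lra.
lra.
Qed.

(** Half of the quartic gain absorbs the [rho] term. The rest, [a ^+ 2 / 8 * u ^+ 2 - K * u], has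
    minimum [- 2 * K ^+ 2 / a ^+ 2], and [K / a <= 1 / 5] makes this bound linear in [K / a]. *)
Lemma coord_excess_ge (R : realType) (rho K a t : R) :
  0 < a -> 0 <= K -> 5 * K <= a -> 4 * rho <= a ^+ 2 ->
  - (2 * K / (5 * a)) <= coord_excess rho K a t.
Proof.
move=> a0 K0 Ka ra; rewrite /coord_excess -(real_normK (num_real t)).
move: (`|t|) => u.
have le1 : a ^+ 2 / 8 * u ^+ 2 - K * u <=
    a ^+ 2 / 4 * u ^+ 2 - K * u - rho / 2 * u ^+ 2.
  by have := sqr_ge0 u; nra.
apply: le_trans le1; pose r := K / a.
have r0 : 0 <= r by rewrite divr_ge0// ltW.
have KE : K = r * a by rewrite /r divfK// gt_eqF.
have r5 : 5 * r <= 1 by rewrite /r mulrA ler_pdivrMr// mul1r.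
have -> : 2 * K / (5 * a) = 2 / 5 * r by rewrite /r; field; rewrite gt_eqF.
(* Completing the square, with the vertex at [u = 4 * K / a ^+ 2]. *)
have := sqr_ge0 (a * u - 4 * r); rewrite KE; nra.
Qed.

Lemma coord_excess_sum_ge (R : realType) (n : nat) (P : pred 'I_n)
    (rho K a c : R) (t : 'I_n -> R) :
  0 < a -> 0 <= K -> 5 * K <= a -> 4 * rho <= a ^+ 2 ->
  n%:R * K <= c * a -> - c <= \sum_(i | P i) coord_excess rho K a (t i).
Proof.
move=> a0 K0 Ka ra nK; pose e := 2 * K / (5 * a).
have e0 : 0 <= e by rewrite divr_ge0// mulr_ge0// ltW.
apply: (@le_trans _ _ (\sum_(i | P i) - e)); last first.
  by apply: ler_sum => i _; exact: coord_excess_ge.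
(* Since [e] is nonnegative, the sum over [P] may be enlarged to all [n] indices. *)
rewrite sumrN lerN2.
apply: (@le_trans _ _ (\sum_(i < n) e)).
  by rewrite big_mkcond; apply: ler_sum => i _; case: ifP.
rewrite sumr_const card_ord -mulr_natl /e mulrA ler_pdivrMr ?mulr_gt0//.
have : 0 <= n%:R * K by rewrite mulr_ge0.
lra.
Qed.

(** * Consequences of the threshold, and the theorem *)

Lemma alpha_star_lt (R : realType) (n : nat) (S : 'M[R]_n) (mu : 'cV[R]_n)
    (beta a : R) : 0 <= beta -> alpha_star S mu beta < a ->
  let K := beta + max_row_sum S + max_entry mu in
  [/\ 1 < a, n%:R * K < a,
      0 < min_gap S mu -> 2 * (n%:R * K) < min_gap S mu * a,
      5 * (K + max_row_sum S + 1) < a & 4 * max_row_sum S < a ^+ 2].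
Proof.
move=> b0 + K; rewrite /alpha_star !gt_max ger0_norm//.
move=> /and5P[a1 aC aG a5 _].
have r0 := max_row_sum_ge0 S; have m0 := max_entry_ge0 mu.
(* [C_star] dominates [n%:R * K] term by term, so the entries [C] and [2 * C / min_gap] of the
   maximum give the second and third bounds. *)
have nK : n%:R * K <= C_star S mu beta.
  by rewrite /C_star ger0_norm// ler_wpM2l// /K; lra.
split=> //.
- exact: le_lt_trans aC.
- move=> g0; move: aG; rewrite ltr_pdivrMr// (mulrC a).
  by apply: le_lt_trans; rewrite ler_pM2l.
- by rewrite /K; lra.
(* [a ^+ 2 > a], and [a] exceeds [5 * (2 * R_* + 1)]. *)
- nra.
Qed.

Unset Implicit Arguments.
Set Strict Implicit.

Theorem theorem2 (R : realType) (n : nat) (S : 'M[R]_n) (mu : 'cV[R]_n)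
    (beta alpha : R) (x0 : 'cV[R]_n)
    (hn : (1 <= n)%N)
    (S_sym : S^T = S)
    (S_diag : forall i, S i i = 0)
    (beta_gt0 : 0 < beta)
    (alpha_gt : alpha_star S mu beta < alpha)
    (x0_min : is_global_min setT (aSB_potential S mu beta alpha) x0) :
  is_global_min (@cube R n) (ising_energy S mu) (sgn x0).
Proof.
have b0 := ltW beta_gt0.
have [a1 aC aG a5 ra] := alpha_star_lt b0 alpha_gt.
have r0 := max_row_sum_ge0 S; have m0 := max_entry_ge0 mu.
set K := beta + max_row_sum S + max_entry mu in aC aG a5.
have K0 : 0 <= K by rewrite /K; lra.
have a0 : 0 < alpha by lra.
have K5 : 5 * K <= alpha by lra.
pose y := alpha^-1 *: x0.
have x0E : x0 = alpha *: y by rewrite scalerA divff ?gt_eqF// scale1r.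
(* Choosing 1 at zero coordinates puts [s] in the cube before [x0] is known to have no zeros. *)
pose s : 'cV[R]_n := \col_i (if x0 i 0 < 0 then -1 else 1).
have cs : cube s by move=> i; rewrite mxE; case: ifP => _; [left | right].
have ys i : y i 0 = s i 0 * `|y i 0|.
  rewrite !mxE normrM (gtr0_norm (_ : 0 < alpha^-1)) ?invr_gt0//.
  case: ltP => h; first by rewrite ltr0_norm//; ring.
  by rewrite ger0_norm//; ring.
have excess v (cv : cube v) : \sum_i coord_excess (max_row_sum S) K alpha
    (`|y i 0| - 1) <= ising_energy S mu v - ising_energy S mu s.
  by apply: (aSB_minimizer_excess S_sym b0) => //; rewrite -x0E; apply: x0_min.2.
have x0_neq0 i : x0 i 0 != 0.
  apply/eqP => xi0; have := excess s cs; rewrite subrr leNgt => /negP; apply.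
  have yi0 : y i 0 = 0 by rewrite mxE xi0 mulr0.
  (* At [t = -1] the term is [alpha ^+ 2 / 4 - K - R_* / 2], above 1 since
     [alpha > 5 * (K + R_* + 1)]. The other terms total at least -1, so the sum cannot be at most
     0. *)
  rewrite (bigD1 i)//= yi0 normr0 sub0r /coord_excess sqrrN normrN normr1.
  have := @coord_excess_sum_ge _ _ (predC1 i) _ _ _ 1
    (fun i => `|y i 0| - 1) a0 K0 K5 (ltW ra).
  rewrite mul1r => /(_ (ltW aC)); nra.
have -> : sgn x0 = s.
  apply/matrixP => i j; rewrite !mxE (ord1 j).
  case: ltP => h; first exact: ltr0_sg.
  by rewrite gtr0_sg// lt_def x0_neq0.
split=> // v cv; rewrite leNgt; apply/negP => lt_v.
have [[/eqP g_neq0 [v1 [v2 [_ _ gE]]]] gmin] : is_global_min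
    (energy_gaps S mu) id (min_gap S mu).
  apply: min_gapP; exists s, v; split=> // e.
  by rewrite e ltxx in lt_v.
have g0 : 0 < min_gap S mu by rewrite lt_def g_neq0 gE normr_ge0.
have gap_le : min_gap S mu <= ising_energy S mu s - ising_energy S mu v.
  apply: (gmin (ising_energy S mu s - ising_energy S mu v)); split.
    by apply/eqP; rewrite subr_eq0 gt_eqF.
  by exists s, v; split; rewrite // ger0_norm// subr_ge0 ltW.
(* The sum is at least minus half the gap, whereas [excess v] and [gap_le] force it to be at most
   minus the full gap. *)
have := @coord_excess_sum_ge _ _ predT _ _ _
  (min_gap S mu / 2) (fun i => `|y i 0| - 1) a0 K0 K5 (ltW ra).
have nK : n%:R * K <= min_gap S mu / 2 * alpha by have := aG g0; lra.
move=> /(_ nK); have := excess v cv; lra.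
Qed.
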